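(* The problem $\textsc{ssmSAT}^{\le}_{\mathrm{bin}}[\mathfrak{S}]$ is in NEXPTIME, where $\mathfrak{S}=\mathfrak{S}_{\mathrm{ti}}\cup\mathfrak{S}_{\mathrm{diag}}$: given an SSM $\mathcal{S}\in\mathfrak{S}$ over an alphabet $\Sigma$ and a number $n\in\mathbb{N}$ encoded in binary, decide whether there is a word $w\in\Sigma^*$ with $|w|\le n$ and $\mathcal{S}(w)=1$.
   Context: A feedforward neural network (FNN) is a composition of layers of nodes, each node computing $\mathbf{x}\mapsto\mathit{relu}(\sum_i c_ix_i+b)$ with $\mathit{relu}(x)=\max(0,x)$. An SSM layer of dimension $d$ is a tuple $(\mathbf{h}_0,\mathit{gate},\mathit{inc},\phi)$ with $\mathbf{h}_0\in\mathbb{R}^d$, $\mathit{gate}\colon\mathbb{R}^d\to\mathbb{R}^{d\times d}$, $\mathit{inc}\colon\mathbb{R}^d\to\mathbb{R}^d$, $\phi\colon\mathbb{R}^d\times\mathbb{R}^d\to\mathbb{R}^d$ (computed by an FNN); on input $\mathbf{x}_1\cdots\mathbf{x}_k$ it computes $\mathbf{h}_t=\mathit{gate}(\mathbf{x}_t)\mathbf{h}_{t-1}+\mathit{inc}(\mathbf{x}_t)$ and outputs $\mathbf{z}_t=\phi(\mathbf{h}_t,\mathbf{x}_t)$. An SSM over a finite alphabet $\Sigma$ with $L$ layers is a tuple $(\mathit{emb},l_1,\dots,l_L,\mathit{out})$ with $\mathit{emb}\colon\Sigma\to\mathbb{R}^d$, SSM layers $l_j$, and $\mathit{out}$ computed by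 an FNN; on $w=a_1\cdots a_k$ it sets $\mathbf{x}^0_i=\mathit{emb}(a_i)$, applies the layers in sequence, and outputs $\mathcal{S}(w)=\mathit{out}(\mathbf{x}^L_k)$. All weights and constants are finitely represented. $\mathfrak{S}_{\mathrm{ti}}$: every $\mathit{gate}$ is a constant matrix; $\mathfrak{S}_{\mathrm{diag}}$: every $\mathit{gate}(\mathbf{x})$ is diagonal. The size of an SSM is $|\mathcal{S}|=|\Sigma|+L+d$, and its syntactic representation is assumed to have size polynomial in $|\mathcal{S}|$; standing assumption (polynomial-evaluation property): $\mathcal{S}(w)$ can be computed in time polynomial in $|\mathcal{S}|+|w|$. *)

(* Defs.v *)
From HB Require Import structures.
From mathcomp Require Import all_boot all_order all_algebra reals.

Set Implicit Arguments.
Unset Strict Implicit.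
Unset Printing Implicit Defensive.

Import Order.TTheory GRing.Theory Num.Theory.

(** * Nondeterministic multi-tape Turing machines *)

Variant move := MoveLeft | Stay | MoveRight.

Definition move_code (m : move) : option bool :=
  match m with MoveLeft => Some false | Stay => None | MoveRight => Some true end.
Definition move_decode (b : option bool) : move :=
  match b with Some false => MoveLeft | None => Stay | Some true => MoveRight end.
Lemma move_codeK : cancel move_code move_decode. Proof. by case. Qed.
HB.instance Definition _ := Equality.copy move (can_type move_codeK).
HB.instance Definition _ := Choice.copy move (can_type move_codeK).
HB.instance Definition _ := Countable.copy move (can_type move_codeK).
HB.instance Definition _ := Finite.copy move (can_type move_codeK).

(* [None] is the blank; [inl a] is an input symbol, [inr g] a work symbol. *)
Notation cell A G := (option (A + G)%type).

(* A machine with input alphabet [A] and [(ntapes M).+1] tapes.  A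
   configuration in which no transition applies is halting, and it accepts if
   its state is in [accepting]. *)
Record tm (A : finType) := Tm {
  ntapes : nat;
  work : finType;
  state : finType;
  start : state;
  accepting : pred state;
  trans : state -> {ffun 'I_ntapes.+1 -> cell A work} ->
          {set state * {ffun 'I_ntapes.+1 -> cell A work * move}} }.

(* Two-way infinite tape: the cells left of the head (nearest first), then the
   scanned cell and the cells to its right; all unlisted cells are blank. *)
Definition tape (C : Type) := (seq (option C) * seq (option C))%type.

Section Tape.
Variable C : Type.
Implicit Type t : tape C.

Definition scan t : option C := head None t.2.

Definition write (c : option C) t : tape C := (t.1, c :: behead t.2).

Definition shift (m : move) t : tape C :=
  match m with
  | MoveLeft => (behead t.1, head None t.1 :: t.2)
  | Stay => t
  | MoveRight => (scan t :: t.1, behead t.2)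
  end.
End Tape.

Section Runs.
Variables (A : finType) (M : tm A).

Definition config :=
  (state M * ('I_(ntapes M).+1 -> tape (A + work M)%type))%type.

Definition word_on_tape (x : seq A) : seq (cell A (work M)) :=
  [seq Some (inl a) | a <- x].

Definition init (x : seq A) : config :=
  (start M, fun i => if i == ord0 then ([::], word_on_tape x) else ([::], [::])).

Definition scanned (c : config) : {ffun 'I_(ntapes M).+1 -> cell A (work M)} :=
  [ffun i => scan (c.2 i)].

Definition step (c c' : config) : Prop :=
  exists2 a, a \in trans c.1 (scanned c) &
    c'.1 = a.1 /\ forall i, c'.2 i = shift (a.2 i).2 (write (a.2 i).1 (c.2 i)).

Fixpoint steps (t : nat) (c c' : config) : Prop :=
  if t is t'.+1 then exists2 c1, step c c1 & steps t' c1 c' else c = c'.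

Definition halting (c : config) : Prop := trans c.1 (scanned c) = set0.

Definition accepts (x : seq A) : Prop :=
  exists t c, [/\ steps t (init x) c, halting c & accepting c.1].

(* Every computation path on [x] has at most [T] steps. *)
Definition halts_within (T : nat) (x : seq A) : Prop :=
  forall t c, steps t (init x) c -> t <= T.

Definition deterministic : Prop := forall q s, #|trans (t := M) q s| <= 1.

(* The output is the word on the first tape that starts at the head and ends
   before the first blank. *)
Definition outputs (c : config) (y : seq A) : Prop :=
  exists2 r, (c.2 ord0).2 = word_on_tape y ++ r & head None r = None.

Definition computes_within (T : nat) (x y : seq A) : Prop :=
  exists t c, [/\ t <= T, steps t (init x) c, halting c & outputs c y].
End Runs.

(** * NEXPTIME *)

(* Only words that encode instances matter: a problem constrains a machine on
   [is_instance] only.  A language is a problem whose instances are all words. *)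
Record problem (A : finType) := Problem {
  is_instance : seq A -> Prop;
  is_yes : seq A -> Prop }.

Definition NTIME (A : finType) (T : nat -> nat) (P : problem A) : Prop :=
  exists M : tm A, forall x, is_instance P x ->
    halts_within M (T (size x)) x /\ (is_yes P x <-> accepts M x).

Definition poly_bound (c k m : nat) : nat := c * m ^ k + c.

Definition NEXPTIME (A : finType) (P : problem A) : Prop :=
  exists c k, NTIME (fun m => 2 ^ poly_bound c k m) P.

(** * Feedforward networks and state space models *)

Local Open Scope ring_scope.

(* [fnn R m n]: networks computing functions R^m -> R^n.  In [fnn_layer W b],
   row [i] of [W] and entry [i] of [b] are the weights and bias of node [i]. *)
Inductive fnn (R : Type) : nat -> nat -> Type :=
| fnn_layer m n (W : 'M[R]_(n, m)) (b : 'cV[R]_n) : fnn R m n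
| fnn_comp m n p (N1 : fnn R m n) (N2 : fnn R n p) : fnn R m p.

Definition relu (R : realType) (x : R) : R := Num.max 0 x.

Fixpoint fnn_eval (R : realType) m n (N : fnn R m n) : 'cV[R]_m -> 'cV[R]_n :=
  match N with
  | fnn_layer _ _ W b => fun x => map_mx (@relu R) (W *m x + b)
  | fnn_comp _ _ _ N1 N2 => fun x => fnn_eval N2 (fnn_eval N1 x)
  end.

(* All weights and biases satisfy [P]. *)
Fixpoint fnn_over (R : Type) (P : R -> Prop) m n (N : fnn R m n) : Prop :=
  match N with
  | fnn_layer _ _ W b => (forall i j, P (W i j)) /\ (forall i, P (b i ord0))
  | fnn_comp _ _ _ N1 N2 => fnn_over P N1 /\ fnn_over P N2
  end.

Record ssm_layer (R : realType) (d : nat) := SsmLayer {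
  h0 : 'cV[R]_d;
  gate : 'cV[R]_d -> 'M[R]_d;
  inc : 'cV[R]_d -> 'cV[R]_d;
  phi : fnn R (d + d) d }.

Record ssm (R : realType) := Ssm {
  alphabet : finType;
  dim : nat;
  emb : alphabet -> 'cV[R]_dim;
  layers : seq (ssm_layer R dim);
  out : fnn R dim 1 }.

Section Semantics.
Variable R : realType.

(* The sequence h_1, ..., h_k. *)
Definition hidden d (l : ssm_layer R d) (xs : seq 'cV[R]_d) : seq 'cV[R]_d :=
  scanl (fun h x => gate l x *m h + inc l x) (h0 l) xs.

Definition layer_eval d (l : ssm_layer R d) (xs : seq 'cV[R]_d) : seq 'cV[R]_d :=
  [seq fnn_eval (phi l) (col_mx hx.1 hx.2) | hx <- zip (hidden l xs) xs].

(* The output is read off the last position, hence undefined ([None]) on the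
   empty word. *)
Definition ssm_eval (S : ssm R) (w : seq (alphabet S)) : option R :=
  if foldl (fun xs l => layer_eval l xs) (map (@emb R S) w) (layers S)
    is x :: xs
  then Some (fnn_eval (out S) (last x xs) ord0 ord0) else None.

Definition ssm_size (S : ssm R) : nat :=
  (#|alphabet S| + size (layers S) + dim S)%N.

Definition all_layers d (P : ssm_layer R d -> Prop) (ls : seq (ssm_layer R d)) :
  Prop := forall j : 'I_(size ls), P (tnth (in_tuple ls) j).

Definition time_invariant (S : ssm R) : Prop :=
  all_layers (fun l => exists A, forall x, gate l x = A) (layers S).

Definition diagonal (S : ssm R) : Prop :=
  all_layers (fun l => forall x, is_diag_mx (gate l x)) (layers S).

Definition ssm_over (P : R -> Prop) (S : ssm R) : Prop :=
  [/\ forall a i, P (emb (s := S) a i ord0),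
      all_layers (fun l => (forall i, P (h0 l i ord0)) /\ fnn_over P (phi l))
        (layers S)
    & fnn_over P (out S)].
End Semantics.

(** * Representations and the satisfiability problem *)

(* Words over 0, 1 and a separator. *)
Notation symbol := (option bool).
Definition sep : symbol := None.
Definition unary (m : nat) : seq symbol := nseq m (Some true).

Section Satisfiability.
Variable R : realType.

(* [num r] is the finite representation of the number [r], if it has one;
   [ssm_of s] is the SSM described by [s], if any. *)
Variables (num : R -> option (seq bool)) (ssm_of : seq bool -> option (ssm R)).

(* An SSM is written as |Sigma|, L and d in unary, followed by a description of
   its components.  The unary parts have total length |S|. *)
Definition enc_ssm (S : ssm R) (s : seq bool) : seq symbol :=
  unary #|alphabet S| ++ sep :: unary (size (layers S)) ++ sep ::
  unary (dim S) ++ sep :: map Some s.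

Definition enc_letter (S : ssm R) (a : alphabet S) : seq symbol :=
  rcons (unary (enum_rank a)) sep.

Definition enc_word (S : ssm R) (w : seq (alphabet S)) : seq symbol :=
  flatten (map (@enc_letter S) w).

(* Least significant bit first. *)
Definition nat_of_bits (bs : seq bool) : nat :=
  foldr (fun (b : bool) v => b + v.*2)%N 0%N bs.

Definition representation_poly_size : Prop :=
  exists c k, forall s S, ssm_of s = Some S ->
    (size s <= poly_bound c k (ssm_size S))%N.

Definition weights_represented : Prop :=
  forall s S, ssm_of s = Some S -> ssm_over (fun r => num r <> None) S.

(* A single machine computes the representation of S(w) from S and w, in time
   polynomial in |S| + |w|. *)
Definition polynomial_evaluation : Prop :=
  exists (M : tm symbol) (c k : nat), deterministic M /\
    forall s S w r, ssm_of s = Some S -> ssm_eval (S := S) w = Some r ->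
    exists2 u, num r = Some u &
      computes_within M (poly_bound c k (ssm_size S + size w))
        (enc_ssm S s ++ sep :: enc_word w) (map Some u).

Definition enc_instance (S : ssm R) (s bs : seq bool) : seq symbol :=
  enc_ssm S s ++ sep :: map Some bs.

Definition ssmSAT_le_bin (class : ssm R -> Prop) : problem symbol := {|
  is_instance := fun x => exists s S bs,
    [/\ ssm_of s = Some S, class S & x = enc_instance S s bs];
  is_yes := fun x => exists s S bs,
    [/\ ssm_of s = Some S, class S, x = enc_instance S s bs
      & exists2 w : seq (alphabet S),
          (size w <= nat_of_bits bs)%N & ssm_eval w = Some 1] |}.
End Satisfiability.

(* Main.v *)
Require Import Defs.
From HB Require Import structures.
From mathcomp Require Import all_boot all_order all_algebra reals zify.

Set Implicit Arguments.
Unset Strict Implicit.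
Unset Printing Implicit Defensive.

(** A nondeterministic machine guesses the word [w] and then runs the evaluation
machine [M] on the SSM and [w], accepting if the output is the fixed
representation [u] of 1; as [num] is injective, this means S(w) = 1.  The word is
guessed backwards, letter by letter, and the binary bound [n] is decremented at
each letter, so at most [n < 2 ^ size bs] letters are guessed.  Hence [M] runs for
a time polynomial in |S| + n, which is exponential in the size of the instance.
The empty word has no value and [M] is only known to halt on words that have one,
so at least one letter is guessed. *)

(** * Runs up to trailing blanks *)

Section TapeEquivalence.
Variable C : Type.
Implicit Type t : tape C.

Definition update (a : option C * move) t : tape C := shift a.2 (write a.1 t).

(** Trailing blanks are implicit in [tape], while writing can make them explicit, so configurations
    are compared only up to this equivalence. *)
Definition tape_eq t t' : Prop :=
  (forall n, nth None t.1 n = nth None t'.1 n) /\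
  (forall n, nth None t.2 n = nth None t'.2 n).

Lemma tape_eq_refl t : tape_eq t t. Proof. by []. Qed.

Lemma tape_eq_sym t t' : tape_eq t t' -> tape_eq t' t.
Proof. by case=> h1 h2; split=> n; rewrite ?h1 ?h2. Qed.

Lemma scan_eq t t' : tape_eq t t' -> scan t = scan t'.
Proof. by case=> _ /(_ 0); rewrite !nth0. Qed.

Lemma update_eq a t t' : tape_eq t t' -> tape_eq (update a t) (update a t').
Proof.
case: a t t' => c m [l r] [l' r'] [/= hl hr].
have hr' n : nth None (behead r) n = nth None (behead r') n by rewrite !nth_behead.
have hl' n : nth None (behead l) n = nth None (behead l') n by rewrite !nth_behead.
have hh : head None l = head None l' by rewrite -!nth0.
have hw n : nth None (c :: behead r) n = nth None (c :: behead r') n by case: n.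
by case: m; split=> //= -[|n] //=; rewrite ?hh.
Qed.

Lemma update_scan t : tape_eq (update (scan t, Stay) t) t.
Proof. by case: t => l [|c r]; split=> [] [|[|n]]. Qed.
End TapeEquivalence.
#[global] Hint Resolve tape_eq_refl : core.

(** * Termination and acceptance of all runs *)

Section Decides.
Variables (A : finType) (M : tm A).
Implicit Types c d : config M.

Definition config_eq c d : Prop := c.1 = d.1 /\ forall i, tape_eq (c.2 i) (d.2 i).

(* Termination, soundness and completeness of all runs from [c] in a single
   notion, established backwards from the halting configurations. *)
Definition decides c (T : nat) (P : Prop) : Prop :=
  (forall t d, steps t c d -> t <= T) /\
  ((exists t d, [/\ steps t c d, halting d & accepting d.1]) <-> P).

(** [step] fixes the new tapes only pointwise; this is a canonical successor, and every other
    successor under [a] is [config_eq] to it. *)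
Definition apply_action (a : state M * {ffun 'I_(ntapes M).+1 -> cell A (work M) * move})
  c : config M := (a.1, fun i => update (a.2 i) (c.2 i)).

Lemma config_eq_sym c d : config_eq c d -> config_eq d c.
Proof. by case=> h1 h2; split=> // i; apply: tape_eq_sym. Qed.

Lemma scanned_eq c d : config_eq c d -> scanned c = scanned d.
Proof. by case=> _ h; apply/ffunP=> i; rewrite !ffunE; apply: scan_eq. Qed.

Lemma step_eq c c' d : config_eq c c' -> step c d -> exists2 d', step c' d' & config_eq d d'.
Proof.
move=> e [a ha [h1 h2]]; exists (apply_action a c').
  by exists a; rewrite -?(scanned_eq e) -?e.1.
split=> // i; rewrite h2; apply: (update_eq (a.2 i)); exact: e.2.
Qed.

Lemma steps_eq t c c' d : config_eq c c' -> steps t c d ->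
  exists2 d', steps t c' d' & config_eq d d'.
Proof.
elim: t c c' => [|t IH] c c' e /=; first by move=> <-; exists c'.
case=> c1 /(step_eq e) [c1' s1 e1] /(IH _ _ e1) [d' s2 e2].
by exists d' => //; exists c1'.
Qed.

Lemma decides_eq c c' T P : config_eq c c' -> decides c T P -> decides c' T P.
Proof.
move=> e [hT hP]; have e' := config_eq_sym e; split.
  by move=> t d /(steps_eq e') [d' /hT].
rewrite -hP; split=> -[t [d [hs hh ha]]].
  have [d' hs' ed] := steps_eq e' hs; exists t, d'; split=> //.
    by rewrite /halting -ed.1 -(scanned_eq ed).
  by rewrite -ed.1.
have [d' hs' ed] := steps_eq e hs; exists t, d'; split=> //.
  by rewrite /halting -ed.1 -(scanned_eq ed).
by rewrite -ed.1.
Qed.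

Lemma decides_weaken c T T' (P P' : Prop) :
  T <= T' -> (P <-> P') -> decides c T P -> decides c T' P'.
Proof.
move=> hT hP [h1 h2]; split; last by rewrite -hP.
by move=> t d /h1 /leq_trans; apply.
Qed.

Lemma decides_halting c T : halting c -> decides c T (accepting c.1).
Proof.
move=> hh; split.
  by case=> // t d [c1 [a]]; rewrite hh inE.
split; last by exists 0, c.
case=> -[|t] [d []] /=; first by move=> ->.
by case=> c1 [a]; rewrite hh inE.
Qed.

(** Since [c] is not halting, the empty run does not accept, so acceptance is decided by the
    successors alone. *)
Lemma decides_step c T Q : ~ halting c ->
  (forall a, a \in trans c.1 (scanned c) -> decides (apply_action a c) T (Q a)) ->
  decides c T.+1 (exists2 a, a \in trans c.1 (scanned c) & Q a).
Proof.
move=> nh hQ; split.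
  case=> // t d [c1 [a ha [h1 h2]]]; have [hT _] := hQ a ha.
  have e : config_eq c1 (apply_action a c) by split=> // i; rewrite h2.
  by case/(steps_eq e)=> d' /hT.
split.
  case=> -[|t] [d []] /=; first by move=> <-.
  case=> c1 [a ha [h1 h2]] hs hh hd; exists a => //.
  have e : config_eq (apply_action a c) c1 by split=> // i; rewrite h2.
  by have [_ <-] := decides_eq e (hQ a ha); exists t, d.
case=> a ha /(proj2 (proj2 (hQ a ha))) [t [d [hs hh hd]]].
by exists t.+1, d; split=> //; exists (apply_action a c) => //; exists a.
Qed.

Lemma decides_step1 c b T P : trans c.1 (scanned c) = [set b] ->
  decides (apply_action b c) T P -> decides c T.+1 P.
Proof.
move=> e h; have nh : ~ halting c.
  by rewrite /halting e => /setP /(_ b); rewrite !inE eqxx.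
apply: decides_weaken (@decides_step c T (fun=> P) nh _) => //.
  by rewrite e; split=> [[]//|]; exists b; rewrite ?inE.
by move=> a; rewrite e inE => /eqP ->.
Qed.
End Decides.

(** * The guessing machine *)

Variant control := Back | Letter | Right | Find | Dec | Ret | Copy | Accept.

Definition control_code (q : control) : bool * bool * bool :=
  match q with
  | Back => (false, false, false) | Letter => (false, false, true)
  | Right => (false, true, false) | Find => (false, true, true)
  | Dec => (true, false, false) | Ret => (true, false, true)
  | Copy => (true, true, false) | Accept => (true, true, true)
  end.
Definition control_decode (b : bool * bool * bool) : control :=
  match b with
  | (false, false, false) => Back | (false, false, true) => Letter
  | (false, true, false) => Right | (false, true, true) => Find
  | (true, false, false) => Dec | (true, false, true) => Ret
  | (true, true, false) => Copy | (true, true, true) => Accept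
  end.
Lemma control_codeK : cancel control_code control_decode. Proof. by case. Qed.
HB.instance Definition _ := Equality.copy control (can_type control_codeK).
HB.instance Definition _ := Choice.copy control (can_type control_codeK).
HB.instance Definition _ := Countable.copy control (can_type control_codeK).
HB.instance Definition _ := Finite.copy control (can_type control_codeK).

Section Machine.
Variables (M : tm symbol) (u : seq bool).

Notation mcell := (cell symbol (work M)).
Notation bit b := (Some (inl (Some b))).
Notation csep := (Some (inl None)).

Definition gcontrol : finType := (control + 'I_(size u).+1)%type.
Definition gstate : finType := (gcontrol + state M)%type.

(* [delta] only sees tape 0, holding the instance, and tape 1, the input tape of
   [M].  Each round of [Back], ..., [Ret] prepends a guessed letter to tape 1
   and decrements the length bound in place; [Copy] prepends the description of
   the SSM; the control [inr j] compares the output of [M] with [u] from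
   position [j] on. *)
Definition delta (q : gcontrol) (s0 s1 : mcell) :
    seq (gstate * (mcell * move) * (mcell * move)) :=
  match q with
  | inl Back => match s0 with
    | None => [:: (inl (inl Letter), (None, MoveRight), (csep, MoveLeft))]
    | c => [:: (inl (inl Back), (c, MoveLeft), (s1, Stay))]
    end
  | inl Letter => match s0 with
    | bit true => [:: (inl (inl Letter), (bit true, MoveRight), (bit true, MoveLeft));
                      (inl (inl Right), (bit true, Stay), (s1, Stay))]
    | _ => [::]
    end
  | inl Right => match s0 with
    | None => [:: (inl (inl Find), (None, MoveLeft), (s1, Stay))]
    | c => [:: (inl (inl Right), (c, MoveRight), (s1, Stay))]
    end
  | inl Find => match s0 with
    | bit b => [:: (inl (inl Find), (bit b, MoveLeft), (s1, Stay))]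
    | csep => [:: (inl (inl Dec), (csep, MoveRight), (s1, Stay))]
    | _ => [::]
    end
  | inl Dec => match s0 with
    | bit false => [:: (inl (inl Dec), (bit true, MoveRight), (s1, Stay))]
    | bit true => [:: (inl (inl Ret), (bit false, MoveLeft), (s1, Stay))]
    | _ => [::]
    end
  | inl Ret => match s0 with
    | bit b => [:: (inl (inl Ret), (bit b, MoveLeft), (s1, Stay))]
    | csep => [:: (inl (inl Back), (csep, Stay), (s1, Stay));
                  (inl (inl Copy), (csep, Stay), (s1, Stay))]
    | _ => [::]
    end
  | inl Copy => match s0 with
    | None => [:: (inr (start M), (None, Stay), (s1, MoveRight))]
    | c => [:: (inl (inl Copy), (c, MoveLeft), (c, MoveLeft))]
    end
  | inl Accept => [::]
  | inr j =>
    if j == size u :> nat then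
      if s1 == None then [:: (inl (inl Accept), (s0, Stay), (s1, Stay))] else [::]
    else if s1 == bit (nth false u j) then
      [:: (inl (inr (inord j.+1)), (s0, Stay), (s1, MoveRight))]
    else [::]
  end.

(** Tape [lift ord0 j] serves as tape [j] of [M], and tape 0 idles during the simulation. An empty
    transition set means that [M] has halted; control then passes to the comparison with [u]. *)
Definition gtrans (q : gstate) (s : {ffun 'I_(ntapes M).+2 -> mcell}) :
    {set gstate * {ffun 'I_(ntapes M).+2 -> mcell * move}} :=
  match q with
  | inl p => [set a in
      [seq (a.1.1, [ffun i : 'I_(ntapes M).+2 => if unlift ord0 i is Some j then
                          if j == ord0 then a.2 else (s i, Stay) else a.1.2])
      | a <- delta p (s ord0) (s (lift ord0 ord0))]]
  | inr p =>
    let acts := trans p [ffun j => s (lift ord0 j)] in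
    if acts == set0 then [set (inl (inr ord0), [ffun i => (s i, Stay)])]
    else [set (inr a.1, [ffun i : 'I_(ntapes M).+2 =>
                 if unlift ord0 i is Some j then a.2 j else (s i, Stay)])
         | a : state M * {ffun 'I_(ntapes M).+1 -> mcell * move} in acts]
  end.

Definition guesser : tm symbol :=
  @Tm symbol (ntapes M).+1 (work M) gstate (inl (inl Back))
    (pred1 (inl (inl Accept))) gtrans.

(** * Single steps of the guessing control *)

Notation mtape := (tape (symbol + work M)).

(** [t1] takes the place of [ts ord0], so that all tapes of [M] can be passed as [ts]. *)
Definition conf (q : gstate) (t0 t1 : mtape) (ts : 'I_(ntapes M).+1 -> mtape) :
    config guesser :=
  (q, fun i : 'I_(ntapes M).+2 => if unlift ord0 i is Some j then
        if j == ord0 then t1 else ts j else t0).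

Lemma conf_eq q t0 t1 ts t0' t1' ts' :
  tape_eq t0 t0' -> tape_eq t1 t1' -> (forall j, j != ord0 -> tape_eq (ts j) (ts' j)) ->
  config_eq (conf q t0 t1 ts) (conf q t0' t1' ts').
Proof.
move=> h0 h1 hs; split=> //= i.
by case: unliftP => [j|] _ //; case: (eqVneq j ord0) => // /hs.
Qed.

Lemma conf_scanned0 q t0 t1 ts : scanned (conf q t0 t1 ts) ord0 = scan t0.
Proof. by rewrite ffunE /= unlift_none. Qed.

Lemma conf_scannedS q t0 t1 ts j :
  scanned (conf q t0 t1 ts) (lift ord0 j) = scan (if j == ord0 then t1 else ts j).
Proof. by rewrite ffunE /= liftK. Qed.

Lemma decides_delta_nil q t0 t1 ts T :
  delta q (scan t0) (scan t1) = [::] ->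
  decides (conf (inl q) t0 t1 ts) T (q = inl Accept).
Proof.
move=> h; apply: decides_weaken (decides_halting T _); first exact: leqnn.
  by split=> [/eqP [->]|->] /=.
rewrite /halting /= conf_scanned0 conf_scannedS h.
by apply/setP=> a; rewrite !inE.
Qed.

Lemma decides_delta q t0 t1 ts T Q :
  delta q (scan t0) (scan t1) <> [::] ->
  (forall a, a \in delta q (scan t0) (scan t1) ->
     decides (conf a.1.1 (update a.1.2 t0) (update a.2 t1) ts) T (Q a)) ->
  decides (conf (inl q) t0 t1 ts) T.+1
    (exists2 a, a \in delta q (scan t0) (scan t1) & Q a).
Proof.
set c := conf _ _ _ _ => hn hQ.
(* [low] keeps the part of an action that [delta] prescribes. All other tapes idle, which adds at
   most an explicit blank. *)
pose low (b : state guesser * {ffun 'I_(ntapes M).+2 -> mcell * move}) :=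
  (b.1, b.2 ord0, b.2 (lift ord0 ord0)).
have mem b : b \in trans c.1 (scanned c) -> low b \in delta q (scan t0) (scan t1) /\
    config_eq (conf b.1 (update (low b).1.2 t0) (update (low b).2 t1) ts) (apply_action b c).
  rewrite /= inE conf_scanned0 conf_scannedS eqxx => /mapP[[[q' a0] a1] ha ->].
  rewrite /low /= !ffunE /= unlift_none liftK eqxx; split=> //; split=> //= i.
  rewrite ffunE; case: unliftP => [j ij|_] //; case: ifP => // jN0.
  by rewrite ij conf_scannedS jN0; apply/tape_eq_sym/update_scan.
have lift_mem a : a \in delta q (scan t0) (scan t1) ->
    exists2 b, b \in trans c.1 (scanned c) & low b = a.
  move=> ha; eexists.
    rewrite /= inE conf_scanned0 conf_scannedS eqxx; apply/mapP.
    by exists a; last reflexivity.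
  by case: a ha => [[q' a0] a1] _; rewrite /low /= !ffunE /= unlift_none liftK.
have nh : ~ halting c.
  move=> hh; case: (delta _ _ _) hn lift_mem => [//|a l _ /(_ a (mem_head _ _)) [b]].
  by rewrite hh inE.
have hs b : b \in trans c.1 (scanned c) -> decides (apply_action b c) T (Q (low b)).
  by case/mem=> /hQ hb he; apply: decides_eq hb.
have := decides_step nh hs; apply: decides_weaken => //; split.
  by case=> b /mem [hb _] Qb; exists (low b).
by case=> a /lift_mem [b hb <-] Qb; exists b.
Qed.

Lemma decides_delta1 q q' a0 a1 t0 t1 ts T P :
  delta q (scan t0) (scan t1) = [:: (q', a0, a1)] ->
  decides (conf q' (update a0 t0) (update a1 t1) ts) T P ->
  decides (conf (inl q) t0 t1 ts) T.+1 P.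
Proof.
move=> e h; have := @decides_delta q t0 t1 ts T (fun=> P).
rewrite e => hd; apply: decides_weaken (hd _ _) => //.
  by split=> [[] //|hP]; eexists; first exact: mem_head.
by move=> a; rewrite inE => /eqP ->.
Qed.

Lemma decides_delta2 q b c t0 t1 ts T P1 P2 :
  delta q (scan t0) (scan t1) = [:: b; c] -> b != c ->
  decides (conf b.1.1 (update b.1.2 t0) (update b.2 t1) ts) T P1 ->
  decides (conf c.1.1 (update c.1.2 t0) (update c.2 t1) ts) T P2 ->
  decides (conf (inl q) t0 t1 ts) T.+1 (P1 \/ P2).
Proof.
move=> e bc hb hc.
have := @decides_delta q t0 t1 ts T (fun a => if a == b then P1 else P2).
rewrite e => hd; apply: decides_weaken (hd _ _) => //.
  split=> [[a _]|]; first by case: ifP; tauto.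
  case=> hP; first by exists b; rewrite ?eqxx ?inE ?eqxx.
  by exists c; rewrite ?inE ?eqxx ?orbT // eq_sym (negbTE bc).
by move=> a; rewrite !inE; case: (eqVneq a b) => [->|_ /eqP ->].
Qed.

(** * Simulation of the evaluation machine and check of its output *)

Definition embed t0 (c : config M) := conf (inr c.1) t0 (c.2 ord0) c.2.

Lemma embed_scanned t0 c :
  [ffun j => scanned (embed t0 c) (lift ord0 j)] = scanned c.
Proof.
apply/ffunP=> j; rewrite ffunE conf_scannedS ffunE.
by case: eqP => [->|].
Qed.

(** As [M] is deterministic, the given run is forced, so every path of the simulation follows it to
    [d]. *)
Lemma decides_embed_steps t c d t0 T P : deterministic M -> steps t c d ->
  decides (embed t0 d) T P -> decides (embed t0 c) (t + T) P.
Proof.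
move=> det; elim: t c => [|t IH] c /=; first by move=> ->.
case=> c1 [a ha [h1 h2]] /IH h /h {}h.
have ea : trans c.1 (scanned c) = [set a].
  by apply/eqP; rewrite eq_sym eqEcard sub1set ha cards1 det.
rewrite addSn; apply: (@decides_step1 _ guesser (embed t0 c) (inr a.1, [ffun i : 'I_(ntapes M).+2 =>
          if unlift ord0 i is Some j then a.2 j
          else (scanned (embed t0 c) i, Stay)])).
  by rewrite /= embed_scanned ea -cards_eq0 cards1 /= imset_set1.
apply: decides_eq h; apply: config_eq_sym; split=> /=; first by rewrite h1.
move=> i; rewrite ffunE; case: unliftP => [j _|i0].
  by case: eqP => [->|_]; rewrite h2.
by rewrite i0 conf_scanned0; apply: update_scan.
Qed.

Lemma decides_embed_halting c t0 T P : halting c ->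
  decides (conf (inl (inr ord0)) t0 (c.2 ord0) c.2) T P ->
  decides (embed t0 c) T.+1 P.
Proof.
move=> hh h.
apply: (@decides_step1 _ guesser (embed t0 c) (inl (inr ord0), [ffun i => (scanned (embed t0 c) i, Stay)])).
  by rewrite /= embed_scanned hh eqxx.
apply: decides_eq h; apply: config_eq_sym; split=> //= i.
by rewrite !ffunE /=; apply: update_scan.
Qed.

Local Notation W := (word_on_tape M).

(** Induction on the suffix [w] of [u] still to be matched. The output ends at a blank, so
    acceptance requires that blank exactly when [w] is exhausted; any mismatch gets stuck. *)
Lemma decides_check w j t0 l v r ts : w = drop j u -> j <= size u ->
  head None r = None ->
  decides (conf (inl (inr (inord j))) t0 (l, W (map Some v) ++ r) ts) (size w).+1
    (v = w).
Proof.
elim: w j t0 l v => [|b w IH] j t0 l v ew hj hr.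
  have ju : (inord j : 'I_(size u).+1) = size u :> nat.
    rewrite inordK //; apply/eqP; rewrite eqn_leq hj /=.
    by have := congr1 size ew; rewrite size_drop /=; lia.
  case: v => [|b' v] /=.
    apply: decides_delta1; first by rewrite /= ju eqxx /scan /= hr.
    apply: decides_weaken (decides_delta_nil _ 0 _) => //.
  apply: decides_weaken (decides_delta_nil _ 0 _) => //.
  by rewrite /= ju eqxx.
have ltj : j < size u.
  by have := congr1 size ew; rewrite size_drop /=; lia.
have jE : (inord j : 'I_(size u).+1) = j :> nat by rewrite inordK.
have [eb ew'] : b = nth false u j /\ w = drop j.+1 u.
  by move: ew; rewrite (drop_nth false ltj) => -[].
have nj : (inord j : 'I_(size u).+1) == size u :> nat = false.
  by rewrite jE ltn_eqF.
case: v => [|b' v].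
  apply: decides_weaken (decides_delta_nil _ 0 _) => //.
  by rewrite /= nj /scan /= hr.
have [bb|bb] := eqVneq b' b; last first.
  apply: decides_weaken (decides_delta_nil _ 0 _) => //.
    by split=> // -[/eqP]; rewrite (negbTE bb).
  by rewrite /= nj jE -eb /scan /=; case: eqP => // -[/eqP]; rewrite (negbTE bb).
apply: decides_delta1; first by rewrite /= nj jE -eb /scan /= bb eqxx.
rewrite bb; apply: decides_weaken (IH j.+1 _ _ v ew' ltj hr) => //.
by split=> [->|[]].
Qed.

(** * Sweeps *)

(** The head ends on [e], where the next phase takes over. Cells to the left are listed nearest
    first, hence [catrev]. *)
Lemma decides_sweep_left q l e y z t0 l1 c1 r1 ts T P :
  (forall c, c \in z :: l -> delta q c c1 = [:: (inl q, (c, MoveLeft), (c1, Stay))]) ->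
  decides (conf (inl q) (y, e :: catrev l (z :: t0)) (l1, c1 :: r1) ts) T P ->
  decides (conf (inl q) (l ++ e :: y, z :: t0) (l1, c1 :: r1) ts)
    ((size l).+1 + T) P.
Proof.
elim: l z t0 => [|z' l IH] z t0 hq h /=; rewrite addSn.
  by apply: decides_delta1; [apply: hq; rewrite inE|exact: h].
apply: decides_delta1; first by apply: hq; rewrite inE eqxx.
apply: IH h => c hc; apply: hq; by rewrite inE hc orbT.
Qed.

Lemma decides_sweep_right q l y z l1 c1 r1 ts T P :
  (forall c, c \in l -> delta q c c1 = [:: (inl q, (c, MoveRight), (c1, Stay))]) ->
  decides (conf (inl q) (catrev l y, z) (l1, c1 :: r1) ts) T P ->
  decides (conf (inl q) (y, l ++ z) (l1, c1 :: r1) ts) (size l + T) P.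
Proof.
elim: l y => [|c l IH] y hq h //=; rewrite addSn.
apply: decides_delta1; first by apply: hq; rewrite inE eqxx.
by apply: IH h => c' hc; apply: hq; rewrite inE hc orbT.
Qed.

(** Copying from right to left onto a tape that grows to the left preserves the order. The copy ends
    at the blank before the instance; a right move on tape 1 then puts the head on the start of the
    input of [M]. *)
Lemma decides_copy l c z r ts T P :
  (forall t0, decides (conf (inr (start M)) t0 ([:: None], W (catrev l (c :: r))) ts) T P) ->
  decides (conf (inl (inl Copy)) (W l ++ [:: None], Some (inl c) :: z)
    ([::], None :: W r) ts) (size l + T.+2) P.
Proof.
elim: l c z r => [|c' l IH] c z r h; rewrite ?addSn.
  apply: decides_delta1; first reflexivity.
  by apply: decides_delta1; [reflexivity | exact: (h (update _ _))].
by apply: decides_delta1; first reflexivity; apply: (IH _ _ (c :: r)).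
Qed.

Let blanks : 'I_(ntapes M).+1 -> mtape := fun=> ([::], [::]).

(** The bound adds the run of [M], one step of handover and [(size u).+1] steps of comparison. *)
Lemma decides_start B x y t0 : deterministic M ->
  computes_within M B x (map Some y) ->
  decides (conf (inr (start M)) t0 ([:: None], W x) blanks) (B + (size u).+2) (y = u).
Proof.
move=> det [t [c [tB hs hh [r er hr]]]].
apply: (@decides_eq _ _ (embed t0 (init M x))).
  apply: conf_eq => // [|j /negbTE jN0]; first by split=> // -[|[]].
  by rewrite /= jN0.
apply: decides_weaken (decides_embed_steps det hs (T := (size u).+2) (P := y = u) _) => //.
  by rewrite leq_add2r.
apply: decides_embed_halting => //.
have := @decides_check u 0 t0 (c.2 ord0).1 y r c.2; rewrite drop0 -er => /(_ _ _ hr).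
have -> : inord 0 = ord0 :> 'I_(size u).+1 by apply/val_inj; rewrite /= inordK.
by case: (c.2 ord0) => l1 r1; apply.
Qed.

(** * Decrementing the binary bound *)

Lemma cat_nseq_cons (C : Type) i (x : C) s : nseq i x ++ x :: s = nseq i.+1 x ++ s.
Proof. by elim: i => //= i ->. Qed.

(** Borrow propagation from the least significant bit. Zero wraps around to all ones, hence the
    positivity guard in [nat_of_bits_decr]. *)
Fixpoint decr (bs : seq bool) : seq bool :=
  if bs is b :: bs' then if b then false :: bs' else true :: decr bs' else [::].

Lemma size_decr bs : size (decr bs) = size bs.
Proof. by elim: bs => //= -[] //= bs ->. Qed.

Lemma nat_of_bits_decr bs :
  0 < nat_of_bits bs -> nat_of_bits (decr bs) = (nat_of_bits bs).-1.
Proof. by elim: bs => //= -[] //= bs IH h; rewrite IH; lia. Qed.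

Local Notation Z bs := (W (map Some bs)).

(** [i] counts the zeros already turned into ones, all left of the head. A one ends the borrow and
    sends the head back to the separator; a zero bound runs into the blank and gets stuck. *)
Lemma decides_dec bs i y r1 ts T P :
  (0 < nat_of_bits bs -> decides (conf (inl (inl Ret))
     (y, csep :: Z (nseq i true ++ decr bs)) ([::], None :: r1) ts) T P) ->
  decides (conf (inl (inl Dec)) (Z (nseq i true) ++ csep :: y, Z bs)
     ([::], None :: r1) ts) ((size bs).*2 + i + T).+1 (0 < nat_of_bits bs /\ P).
Proof.
elim: bs i => [|[] bs IH] i h.
- by apply: decides_weaken (decides_delta_nil _ 0 _) => //; split=> // -[].
- apply: decides_delta1; first reflexivity.
  have {}h := h isT.
  case: i h => [|i] h.
    by apply: decides_weaken h; [rewrite /=; lia | split=> [|[]]].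
  apply: decides_weaken (@decides_sweep_left (inl Ret) (Z (nseq i true)) _ _ (bit true)
    _ _ _ _ _ T P _ _).
  + by rewrite !size_map size_nseq /=; lia.
  + by split=> [|[]].
  + move=> c; rewrite inE => /orP[/eqP -> //|/mapP[a]].
    by rewrite map_nseq => /nseqP[-> _] ->.
  have e : forall z, catrev (Z (nseq i true)) z = Z (nseq i true) ++ z.
    by move=> z; rewrite catrevE /word_on_tape !map_nseq rev_nseq.
  rewrite e; move: h; rewrite /word_on_tape !map_cat !map_nseq.
  by rewrite cat_nseq_cons.
- apply: decides_delta1; first reflexivity.
  apply: decides_weaken (IH i.+1 _) => /=; first by lia.
    by rewrite double_gt0.
  by move=> hb; have := h; rewrite /= double_gt0 hb => /(_ isT); rewrite cat_nseq_cons.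
Qed.

(** The bound contains no separator, so the last separator of the instance is the one before it: the
    head runs to the right end and searches backwards. *)
Lemma decides_right p a b bs r1 ts T P : p = a ++ b ->
  decides (conf (inl (inl Dec)) (csep :: rev (W p) ++ [:: None], Z bs)
    ([::], None :: r1) ts) T P ->
  decides (conf (inl (inl Right)) (rev (W a) ++ [:: None], W (b ++ sep :: map Some bs))
    ([::], None :: r1) ts) (size b + (size bs).*2 + T + 4) P.
Proof.
move=> -> h; rewrite -[W (b ++ _)]cats0.
apply: decides_weaken (@decides_sweep_right (inl Right) (W (b ++ sep :: map Some bs))
  _ [::] _ _ _ _ (size bs + T + 2) P _ _).
- by rewrite size_map size_cat /= size_map; lia.
- by [].
- by move=> c /mapP[x _ ->].
have {}h : decides (conf (inl (inl Find)) (rev (W (a ++ b)) ++ [:: None],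
    csep :: Z bs ++ [:: None]) ([::], None :: r1) ts) T.+1 P.
  apply: decides_delta1; first reflexivity.
  apply: decides_eq h; apply: conf_eq => //.
  split=> n //=; rewrite nth_cat; case: ltnP => // hn.
  by rewrite nth_default //; case: (n - _) => [|[]].
rewrite catrevE /word_on_tape map_cat /= rev_cat rev_cons -cats1 -!catA /=.
have -> : size bs + T + 2 = (size bs + T.+1).+1 by lia.
rewrite /word_on_tape map_cat rev_cat -catA in h.
(* With [bs] empty the separator is scanned at once, otherwise the last bit is. *)
case: (lastP bs) h => [|bs' b'] h.
  by apply: decides_delta1; first reflexivity.
rewrite !map_rcons rev_rcons size_rcons.
apply: decides_delta1; first reflexivity.
have -> : size bs' = size (rev (Z bs')) by rewrite size_rev !size_map.
apply: (@decides_sweep_left (inl Find)).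
  move=> c; rewrite inE => /orP[/eqP -> //|]; rewrite mem_rev => /mapP[x].
  by case/mapP=> x' _ -> ->.
by rewrite catrevE revK; move: h; rewrite /word_on_tape !map_rcons cat_rcons.
Qed.

(** At each mark of the unary alphabet size the machine copies the mark or stops. Stopping needs an
    unread mark, so [j < A] and the guess is a valid rank. *)
Lemma decides_letter A rest m i r1 ts T Q : i + m = A ->
  (forall j, j < A -> decides (conf (inl (inl Right)) (W (unary j) ++ [:: None],
     W (unary (A - j) ++ sep :: rest)) ([::], None :: W (unary j ++ r1)) ts) T (Q j)) ->
  decides (conf (inl (inl Letter)) (W (unary i) ++ [:: None],
     W (unary m ++ sep :: rest)) ([::], None :: W (unary i ++ r1)) ts) (m + T)
    (exists j, [/\ i <= j, j < A & Q j]).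
Proof.
elim: m i => [|m IH] i eA h.
  apply: decides_weaken (decides_delta_nil _ 0 _) => //; split=> // -[j []].
  by move=> h1 h2; lia.
have iA : i < A by lia.
have {}IH := IH i.+1 (etrans (addSnnS i m) eA) h.
have hi : decides (conf (inl (inl Right)) (W (unary i) ++ [:: None],
    W (unary m.+1 ++ sep :: rest)) ([::], None :: W (unary i ++ r1)) ts) (m + T) (Q i).
  have -> : m.+1 = A - i by lia.
  by apply: decides_weaken (leq_addl _ _) _ (h i iA).
have := @decides_delta2 (inl Letter)
  (inl (inl Letter), (bit true, MoveRight), (bit true, MoveLeft))
  (inl (inl Right), (bit true, Stay), (None, Stay))
  (W (unary i) ++ [:: None], W (unary m.+1 ++ sep :: rest))
  ([::], None :: W (unary i ++ r1)) ts _ _ _ erefl isT IH hi.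
rewrite addSn; apply: decides_weaken => //.
split.
  case=> [[j [h1 h2 h3]]|Qi]; first by exists j; split=> //; lia.
  by exists i.
case=> j []; rewrite leq_eqVlt => /orP[/eqP <-|ij] jA Qj; first by right.
by left; exists j.
Qed.

(** [enc_word] in terms of ranks, which keeps the alphabet out of the analysis of the machine. *)
Definition codeword (js : seq nat) : seq symbol :=
  flatten [seq rcons (unary j) sep | j <- js].

(** * The guessing loop *)

Section Loop.
Variables (A n B : nat) (rest : seq symbol) (Acc : seq nat -> Prop).
Let p := unary A ++ sep :: rest.
Hypothesis M_det : deterministic M.
(** Nonempty lists stand for the words that have a value; the length bound [n] lets a single time
    bound [B] serve all of them. *)
Hypothesis M_correct : forall js, js != [::] -> all (gtn A) js -> size js <= n ->
  exists2 y, computes_within M B (p ++ sep :: codeword js) (map Some y) &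
    y = u <-> Acc js.

Let tail_time := (size p + B + size u + 6)%N.

(** Guessing can stop only here, after a letter, so [M] never starts on the empty word. *)
Lemma decides_ret bs w T P : w != [::] -> all (gtn A) w -> size w <= n ->
  tail_time <= T ->
  decides (conf (inl (inl Back)) ([::], None :: W (p ++ sep :: map Some bs))
    ([::], None :: W (codeword w)) blanks) T P ->
  decides (conf (inl (inl Ret)) (rev (W p) ++ [:: None], csep :: Z bs)
    ([::], None :: W (codeword w)) blanks) (size p + T + 2) (P \/ Acc w).
Proof.
move=> w0 wA wn hT hP; rewrite addn2.
have hback : decides (conf (inl (inl Back)) (rev (W p) ++ [:: None], csep :: Z bs)
    ([::], None :: W (codeword w)) blanks) (size p + T).+1 P.
  have -> : (size p + T).+1 = (size (rev (W p))).+1 + T by rewrite size_rev size_map.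
  apply: decides_sweep_left.
    by move=> c; rewrite inE mem_rev => /orP[/eqP -> //|/mapP[x _ ->]].
  by rewrite catrevE revK; move: hP; rewrite /word_on_tape map_cat.
have hcopy : decides (conf (inl (inl Copy)) (rev (W p) ++ [:: None], csep :: Z bs)
    ([::], None :: W (codeword w)) blanks) (size p + T).+1 (Acc w).
  have [y hy ey] := M_correct w0 wA wn.
  (* The symbol [None] copied first is the separator before the bound; it lands between [p] and the
     codeword, and the bound is left out. *)
  have := @decides_copy (rev p) None (Z bs) (codeword w) blanks (B + (size u).+2) (y = u).
  rewrite catrevE revK => /(_ (fun t0 => decides_start t0 M_det hy)).
  rewrite {1}/word_on_tape map_rev; apply: decides_weaken => //.
  have -> : size (rev p) = size p by rewrite size_rev.
  by move: hT; rewrite /tail_time; lia.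
exact: (@decides_delta2 (inl Ret) _ _ (rev (W p) ++ [:: None], csep :: Z bs)
  ([::], None :: W (codeword w)) blanks _ _ _ erefl isT hback hcopy).
Qed.

(** One pass over the instance: as tape 1 grows to the left, [Back] first writes the separator of
    the new letter, then the marks follow and the bound is decremented. *)
Lemma decides_round bs r1 ts T Q :
  (forall j, j < A -> 0 < nat_of_bits bs -> decides (conf (inl (inl Ret))
     (rev (W p) ++ [:: None], csep :: Z (decr bs))
     ([::], None :: W (unary j ++ sep :: r1)) ts) T (Q j)) ->
  decides (conf (inl (inl Back)) ([::], None :: W (p ++ sep :: map Some bs))
    ([::], None :: W r1) ts) (2 * size p + 4 * size bs + 6 + T)
    (exists j, [/\ j < A, 0 < nat_of_bits bs & Q j]).
Proof.
move=> h.
have hright j : j < A -> decides (conf (inl (inl Right)) (W (unary j) ++ [:: None],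
     W (unary (A - j) ++ sep :: rest ++ sep :: map Some bs))
     ([::], None :: W (unary j ++ sep :: r1)) ts) (size p + 4 * size bs + 5 + T)
     (0 < nat_of_bits bs /\ Q j).
  move=> jA; have hd := decides_dec (i := 0) (h j jA).
  have ep : p = unary j ++ (unary (A - j) ++ sep :: rest).
    by rewrite catA /unary -nseqD subnKC // ltnW.
  have := decides_right ep hd.
  have -> : rev (W (unary j)) = W (unary j) by rewrite /word_on_tape map_nseq rev_nseq.
  rewrite -catA.
  apply: decides_weaken => //.
  by rewrite /p !size_cat !size_nseq /=; lia.
have := decides_letter (add0n A) hright.
have -> : unary A ++ sep :: rest ++ sep :: map Some bs = p ++ sep :: map Some bs.
  by rewrite /p -catA.
move=> hl; have -> : (2 * size p + 4 * size bs + 6 + T)%N =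
  (2 * size p + 4 * size bs + 5 + T).+1 by lia.
apply: decides_delta1; first reflexivity.
apply: decides_weaken hl; first by rewrite /p !size_cat !size_nseq /=; lia.
by split=> [[j [_ jA [? ?]]]|[j [? ? ?]]]; exists j.
Qed.

(** Induction on the remaining bound [v]. The invariant [v + size w <= n] keeps every guessed word
    in the range of [M_correct]; later guesses come in front, hence [js ++ w]. *)
Lemma decides_loop v bs w : nat_of_bits bs = v -> v + size w <= n -> all (gtn A) w ->
  decides (conf (inl (inl Back)) ([::], None :: W (p ++ sep :: map Some bs))
    ([::], None :: W (codeword w)) blanks)
    (v.+1 * (3 * size p + 4 * size bs + 8) + tail_time)
    (exists js, [/\ js != [::], all (gtn A) js, size js <= v & Acc (js ++ w)]).
Proof.
elim: v bs w => [|v IH] bs w ebs hn wA.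
  (* At bound zero a further round gets stuck in [Dec], so nothing has to be shown about its
     continuation. *)
  apply: decides_weaken (decides_round (T := 0) (Q := fun=> False) _) => //.
  - by rewrite mul1n; lia.
  - split=> [[j []] //|[[|j js] [] //]].
  by move=> j _; rewrite ebs.
pose T := (v.+1 * (3 * size p + 4 * size bs + 8) + tail_time)%N.
pose Q j := (exists js, [/\ js != [::], all (gtn A) js, size js <= v
  & Acc (js ++ j :: w)]) \/ Acc (j :: w).
apply: decides_weaken (decides_round (T := (size p + T + 2)%N) (Q := Q) _).
- by rewrite /T mulSn; lia.
- split.
    case=> j [jA _ [[js [js0 jsA jsv hA]]|hA]].
      exists (rcons js j); rewrite -cats1 -catA all_cat jsA /= jA size_cat addn1.
      by split=> //; case: (js).
    by exists [:: j]; rewrite /= jA.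
  (* The last entry of the list is the letter guessed in this round; the entries before it are
     guessed later. *)
  case; case/lastP=> [|js j] [] //; rewrite all_rcons size_rcons cat_rcons.
  move=> _ /andP[jA jsA] hv hA; exists j; rewrite ebs; split=> //.
  case: (eqVneq js [::]) hA => [->|js0] hA; first by right.
  by left; exists js.
move=> j jA; rewrite ebs => _.
have -> : unary j ++ sep :: codeword w = codeword (j :: w).
  by rewrite /codeword /= cat_rcons.
apply: decides_ret => //=; rewrite ?jA //; try by rewrite /T; lia.
rewrite /T -(size_decr bs); apply: IH => //=; rewrite ?jA //; last by lia.
by rewrite nat_of_bits_decr ebs.
Qed.

(** A run starts on the first symbol rather than on the blank before it; the [Back] step between
    them accounts for the [+ 1]. *)
Lemma guesser_decides bs : nat_of_bits bs <= n ->
  decides (init guesser (p ++ sep :: map Some bs))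
    ((nat_of_bits bs).+1 * (3 * size p + 4 * size bs + 8) + tail_time + 1)
    (exists js, [/\ js != [::], all (gtn A) js, size js <= nat_of_bits bs & Acc js]).
Proof.
move=> hn; rewrite addn1.
have [z [x ex]] : exists z x, p ++ sep :: map Some bs = z :: x.
  by rewrite /p; case: A => [|m]; do 2 eexists; reflexivity.
have := @decides_loop _ bs [::] erefl; rewrite addn0 => /(_ hn isT).
rewrite {1}ex => hl.
apply: (@decides_eq _ _ (conf (inl (inl Back)) ([:: None], W (z :: x)) ([::], [:: None]) blanks)).
  split=> // i; rewrite /= ex; case: unliftP => [j ->|->] /=.
    by case: ifP => // _; split=> // -[|[]].
  by split=> // -[|[]].
apply: (@decides_sweep_left (inl Back) [::] None [::] (Some (inl z))).
  by move=> c; rewrite inE => /eqP ->.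
apply: decides_weaken hl => //; split=> -[js [h1 h2 h3 h4]]; exists js.
  by rewrite cats0 in h4.
by rewrite cats0.
Qed.

End Loop.
End Machine.

(** * Time bounds and instances *)

Lemma nat_of_bits_lt bs : nat_of_bits bs < 2 ^ size bs.
Proof. by elim: bs => //= b bs IH; rewrite expnS mul2n; case: b; lia. Qed.

Lemma poly_bound_mono c k m m' : m <= m' -> poly_bound c k m <= poly_bound c k m'.
Proof.
move=> h; rewrite leq_add2r leq_mul2l; apply/orP; right.
by case: k => // k; rewrite leq_exp2r.
Qed.

(** Each of the two summands is at most [2 ^ c * 2 ^ (m * k)]. *)
Lemma poly_bound_exp c k m : poly_bound c k (2 ^ m) <= 2 ^ (c + m * k).+1.
Proof.
rewrite /poly_bound expnS expnD -expnM; set e := 2 ^ (m * k).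
have e0 : 0 < e by rewrite expn_gt0.
have /ltnW hc : c < 2 ^ c by apply: ltn_expl.
have : c * e <= 2 ^ c * e by rewrite leq_mul2r hc orbT.
have : c <= c * e by rewrite leq_pmulr.
by lia.
Qed.

(** The loop, the evaluation and the remaining terms each take at most [2 ^ e] with [e] linear in
    [m]; for the evaluation, [sz + n] is at most [2 ^ m.+1]. *)
Lemma guesser_time c k z m b p n sz : p <= m -> b <= m -> sz <= m -> n < 2 ^ b ->
  n.+1 * (3 * p + 4 * b + 8) + (p + poly_bound c k (sz + n) + z + 6) + 1
    <= 2 ^ poly_bound (18 + k + z + c) 1 m.
Proof.
move=> hp hb hs hn; set e := 8 * m + 15 + z + (c + m.+1 * k).+1.
have hm : m < 2 ^ m by apply: ltn_expl.
have hbm : 2 ^ b <= 2 ^ m by rewrite leq_exp2l.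
have t1 : n.+1 * (3 * p + 4 * b + 8) <= 2 ^ e.
  apply: (@leq_trans (2 ^ m * 2 ^ (7 * m + 8))).
    apply: leq_mul; first by apply: leq_trans hn _.
    by apply: leq_trans (ltnW (ltn_expl (7 * m + 8) (isT : 1 < 2))); lia.
  by rewrite -expnD leq_exp2l // /e; lia.
have t2 : p + z + 7 <= 2 ^ e.
  apply: (@leq_trans (2 ^ (m + z + 7))); last by rewrite leq_exp2l // /e; lia.
  by apply: leq_trans (ltnW (ltn_expl _ (isT : 1 < 2))); lia.
have t3 : poly_bound c k (sz + n) <= 2 ^ e.
  apply: leq_trans (poly_bound_mono c k (_ : _ <= 2 ^ m.+1)) _.
    by rewrite expnS; lia.
  by apply: leq_trans (poly_bound_exp _ _ _) _; rewrite leq_exp2l // /e; lia.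
apply: (@leq_trans (2 ^ e.+2)).
  by rewrite !expnS; lia.
(* [e.+2] equals [(8 + k) * m + (18 + k + z + c)], and its constant term also dominates its
   slope. *)
by rewrite leq_exp2l // /e /poly_bound expn1 mulSn; nia.
Qed.

(** [map Some] yields no separator, so the first separator marks the cut. *)
Lemma cat_sep_inj (s s' : seq bool) (t t' : seq symbol) :
  map Some s ++ sep :: t = map Some s' ++ sep :: t' -> s = s' /\ t = t'.
Proof.
elim: s s' => [|b s IH] [|b' s'] //=; first by case.
by case=> -> /IH [-> ->].
Qed.

(** * Encodings of instances and words *)

Section Instances.
Variable R : realType.
Implicit Type S : ssm R.

Lemma enc_instance_inj S S' s s' bs bs' :
  enc_instance S s bs = enc_instance S' s' bs' -> s = s' /\ bs = bs'.
Proof.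
have unaryE m : unary m = map Some (nseq m true) by rewrite map_nseq.
rewrite /enc_instance /enc_ssm !unaryE -!(catA, cat_cons).
move=> /cat_sep_inj[_] /cat_sep_inj[_] /cat_sep_inj[_] /cat_sep_inj[->].
by move/(inj_map (@Some_inj _)).
Qed.

Lemma ssm_eval_nil S : ssm_eval (S := S) [::] = None.
Proof. by rewrite /ssm_eval /=; elim: (layers S). Qed.

(** Every layer preserves the length, so a last position exists. *)
Lemma ssm_eval_defined S (w : seq (alphabet S)) : w != [::] ->
  exists r, ssm_eval w = Some r.
Proof.
move=> w0; rewrite /ssm_eval; set f := foldl _ _ _.
have : size f = size w.
  rewrite /f -(size_map (@emb R S) w); elim: (layers S) (map _ w) => //= l ls IH xs.
  by rewrite IH size_map size_zip size_scanl minnn.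
by case: f => [|x xs] //=; [case: w w0 | eexists].
Qed.

Lemma enc_word_codeword S (w : seq (alphabet S)) :
  enc_word w = codeword [seq nat_of_ord (enum_rank a) | a <- w].
Proof. by rewrite /codeword -map_comp. Qed.

Lemma word_of_ranks S js : all (gtn #|alphabet S|) js ->
  exists w : seq (alphabet S), [seq nat_of_ord (enum_rank a) | a <- w] = js.
Proof.
elim: js => [|j js IH] /=; first by exists [::].
case/andP=> hj /IH [w <-]; exists (enum_val (Ordinal hj) :: w).
by rewrite /= enum_valK.
Qed.

Lemma ranks_inj S : injective (map (fun a : alphabet S => nat_of_ord (enum_rank a))).
Proof. by apply: inj_map => a b /ord_inj /enum_rank_inj. Qed.
End Instances.

Theorem theorem6 (R : realType)
    (num : R -> option (seq bool)) (ssm_of : seq bool -> option (ssm R))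
    (num_inj : forall r1 r2 u, num r1 = Some u -> num r2 = Some u -> r1 = r2)
    (Hrep : weights_represented num ssm_of)
    (Hsize : representation_poly_size ssm_of)
    (Heval : polynomial_evaluation num ssm_of) :
  NEXPTIME
    (ssmSAT_le_bin ssm_of (fun S : ssm R => time_invariant S \/ diagonal S)).
Proof.
have [M [c [k [M_det M_eval]]]] := Heval.
(* If 1 has no representation, no word has value 1, since [M_eval] provides a representation of
   every value; a machine that halts at once and rejects suffices. *)
case E1 : (num 1%R) => [u|]; last first.
  pose N := @Tm symbol 0 unit unit tt pred0 (fun _ _ => set0).
  exists 0, 0, N => x _; split.
    by case=> // t d [c1 [a]]; rewrite inE.
  split=> [[s [S [bs [hS _ _ [w _ hw]]]]]|[t [d []]] //].
  by have [v] := M_eval _ _ _ _ hS hw; rewrite E1.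
exists (18 + k + size u + c), 1, (guesser M u) => x [s [S [bs [hS hC ->]]]].
pose n := nat_of_bits bs.
pose rest := unary (size (layers S)) ++ sep :: unary (Defs.dim S) ++ sep :: map Some s.
pose Acc js := exists2 w : seq (alphabet S),
  [seq nat_of_ord (enum_rank a) | a <- w] = js & ssm_eval w = Some 1%R.
have M_correct js : js != [::] -> all (gtn #|alphabet S|) js -> size js <= n ->
  exists2 y, computes_within M (poly_bound c k (ssm_size S + n))
    ((unary #|alphabet S| ++ sep :: rest) ++ sep :: codeword js) (map Some y) &
    y = u <-> Acc js.
  move=> js0 /word_of_ranks [w ejs] hn.
  have w0 : w != [::] by move: js0; rewrite -ejs; case: (w).
  have [r hr] := ssm_eval_defined w0.
  have [y hy [t [d [ht hs hh ho]]]] := M_eval _ _ _ _ hS hr.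
  exists y.
    exists t, d; split=> //; last by rewrite -ejs -enc_word_codeword.
    apply: leq_trans ht _; apply: poly_bound_mono.
    by rewrite leq_add2l; move: hn; rewrite -ejs size_map.
  (* Injectivity of [num] turns the output [u] into the value 1. Conversely, ranks determine a word,
     so [w'] is the word on which [M] was run. *)
  split=> [yu|[w' ew' hw']].
    by exists w => //; rewrite hr; congr Some; apply: (num_inj _ _ u); rewrite // -yu.
  move: hw' hy; have -> : w' = w by apply: ranks_inj; rewrite ejs.
  by rewrite hr => -[->]; rewrite E1 => -[].
have [hT hP] := guesser_decides M_det M_correct (leqnn n).
split.
  move=> t d /hT /leq_trans; apply; apply: guesser_time (nat_of_bits_lt bs).
  - by rewrite [leqRHS]size_cat leq_addr.
  - by rewrite [leqRHS]size_cat /= size_map; lia.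
  rewrite /enc_instance /enc_ssm /ssm_size.
  by do 4 rewrite ?(size_cat, size_nseq) /=; lia.
rewrite /accepts hP; split.
  case=> s' [S' [bs' [hS' _ e [w hw hr]]]].
  (* The witness of [is_yes] carries its own data; injectivity of the encoding identifies them with
     the given instance. *)
  have [es eb] := enc_instance_inj e; subst s' bs'.
  move: hS'; rewrite hS => -[eS]; subst S'.
  exists [seq nat_of_ord (enum_rank a) | a <- w]; split; last by exists w.
  - by case: w hr {hw} => //; rewrite ssm_eval_nil.
  - by apply/allP=> j /mapP[a _ ->]; apply: ltn_ord.
  by rewrite size_map.
case=> js [_ _ hn [w ew hw]]; exists s, S, bs; split=> //; exists w => //.
by move: hn; rewrite -ew size_map.
Qed.
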